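(* Let $d\ge1$, $A\in\mathbb{R}^{d\times d}$ and $\xi\in\mathbb{R}^d$. For $H\in(0,1)$ let $(X_t^H)_{t\in[0,1]}$ be the $\mathbb{R}^d$-valued stochastic process defined by $$dX_t^H=AX_t^H\,dt+dB_t^H,\qquad X_0^H=\xi,$$ where $B_t^H=(B_t^{H,1},\dots,B_t^{H,d})$ is a $d$-dimensional fractional Brownian motion with Hurst parameter $H$. Denote by $a_{ij}(t)$ the entries of the matrix $\exp(tA)A$. Then there exists a constant $C>0$, independent of $H$, such that for every $H\in(0,1)$ $$\mathbb{E}\Big[\sup_{t\in[0,1]}\big\|X_t^H-\mathbb{E}[X_t^H]\big\|\Big]\le C d^2C_2+\frac{C d^2C_2\sqrt{\pi}}{2\sqrt{H}},$$ where $$C_2=\max_{1\le i,j\le d}\ \sup_{t\in[0,1]}|a_{ij}(t)|^2+\max_{1\le i,j\le d}\ \sup_{t\in[0,1]}|a_{ij}(t)|+1.$$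
   Context: A one-dimensional fractional Brownian motion on $[0,1]$ with Hurst parameter $H\in(0,1)$ is a centered Gaussian process $(B^H_t)_{t\in[0,1]}$ with continuous paths and covariance $\mathbb{E}[B^H_tB^H_s]=\tfrac12\left(|t|^{2H}+|s|^{2H}-|t-s|^{2H}\right)$. A $d$-dimensional fractional Brownian motion has as components independent one-dimensional fractional Brownian motions with the same Hurst parameter $H$. The linear stochastic differential equation is understood pathwise in integral form: $X^H_t=\xi+\int_0^tAX^H_s\,ds+B^H_t$ for all $t\in[0,1]$ (its unique continuous solution is the $d$-dimensional fractional Ornstein-Uhlenbeck process). $\|\cdot\|$ is the Euclidean norm on $\mathbb{R}^d$. *)

(* Defs.v *)
From HB Require Import structures.
From mathcomp Require Import all_boot all_order all_algebra.
From mathcomp Require Import all_classical all_reals all_analysis.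

Set Implicit Arguments.
Unset Strict Implicit.
Unset Printing Implicit Defensive.

Import Order.TTheory GRing.Theory Num.Theory.
Import numFieldNormedType.Exports.

Local Open Scope classical_set_scope.
Local Open Scope ring_scope.

(* The library norm on matrices is the max norm, hence this definition. *)
Definition norm2 (R : realType) (d : nat) (v : 'cV[R]_d) : R :=
  Num.sqrt (\sum_(i < d) v i 0 ^+ 2).

Definition expmx (R : realType) (d : nat) (M : 'M[R]_d) : 'M[R]_d :=
  lim (series (fun k : nat => (k`!%:R)^-1 *: M ^+ k) @ \oo).

(* Degenerate (almost surely constant) variables count as Gaussian. They are
   listed apart because normal_prob m 0 is not the Dirac mass at m. *)
Definition gaussian_rv (disp : measure_display) (T : measurableType disp)
    (R : realType) (P : probability T R) (Y : T -> R) : Prop :=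
  measurable_fun [set: T] Y /\
  ((exists m : R, {ae P, forall w, Y w = m}) \/
   (exists m s : R, 0 < s /\
      forall U : set R, measurable U -> P (Y @^-1` U) = normal_prob m s U)).

(* Processes indexed by [0,1] are represented by functions of t : R, of which
   only the values at t in `[0, 1] are ever constrained or used. *)
Definition gaussian_process (disp : measure_display) (T : measurableType disp)
    (R : realType) (P : probability T R) (b : R -> T -> R) : Prop :=
  forall (n : nat) (t c : 'I_n -> R), (forall k, t k \in `[0, 1]) ->
    gaussian_rv P (fun w => \sum_(k < n) c k * b (t k) w).

Record fbm1 (disp : measure_display) (T : measurableType disp)
    (R : realType) (P : probability T R) (H : R) (b : R -> T -> R) : Prop := {
  fbm1_gaussian : gaussian_process P b ;
  fbm1_centered : forall t : R, t \in `[0, 1] -> 'E_P[b t]%E = 0%:E ;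
  fbm1_covariance : forall t s : R, t \in `[0, 1] -> s \in `[0, 1] ->
    'E_P[fun w => (b t w * b s w)%R]%E =
      (2^-1 * (`|t| `^ (2 * H) + `|s| `^ (2 * H) - `|t - s| `^ (2 * H)))%:E ;
  fbm1_continuous : forall w : T, {within `[0, 1], continuous (b ^~ w)}
}.

Definition process_sigma (disp : measure_display) (T : measurableType disp)
    (R : realType) (b : R -> T -> R) : set_system T :=
  <<s \bigcup_(t in `[0, 1]) preimage_set_system [set: T] (b t) measurable >>.

Definition mutually_independent (disp : measure_display)
    (T : measurableType disp) (R : realType) (P : probability T R)
    (I : finType) (F : I -> set_system T) : Prop :=
  forall (J : {set I}) (E : I -> set T), (forall i, i \in J -> F i (E i)) ->
    P (\bigcap_(i in [set` J]) E i) = (\prod_(i in J) P (E i))%E.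

Definition fbm (disp : measure_display) (T : measurableType disp)
    (R : realType) (P : probability T R) (d : nat) (H : R)
    (B : R -> T -> 'cV[R]_d) : Prop :=
  (forall i : 'I_d, fbm1 P H (fun t w => B t w i 0)) /\
  mutually_independent P (fun i : 'I_d => process_sigma (fun t w => B t w i 0)).

Record linear_sde_solution (disp : measure_display) (T : measurableType disp)
    (R : realType) (d : nat) (A : 'M[R]_d) (xi : 'cV[R]_d)
    (B X : R -> T -> 'cV[R]_d) : Prop := {
  sde_measurable : forall (t : R) (i : 'I_d), t \in `[0, 1] ->
    measurable_fun [set: T] (fun w => X t w i 0) ;
  sde_continuous : forall w : T, {within `[0, 1], continuous (X ^~ w)} ;
  sde_equation : forall (t : R) (w : T), t \in `[0, 1] ->
    X t w = xi
      + \col_(i < d) (\int[lebesgue_measure]_(s in `[0, t]) (A *m X s w) i 0)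
      + B t w
}.

Definition mean_vector (disp : measure_display) (T : measurableType disp)
    (R : realType) (P : probability T R) (d : nat) (Y : T -> 'cV[R]_d) :
    'cV[R]_d :=
  \col_(i < d) fine 'E_P[fun w => Y w i 0%R]%E.

Definition expected_sup_deviation (disp : measure_display)
    (T : measurableType disp) (R : realType) (P : probability T R) (d : nat)
    (X : R -> T -> 'cV[R]_d) : \bar R :=
  (\int[P]_w
     ereal_sup [set (norm2 (X t w - mean_vector P (X t)))%:E | t in `[0%R, 1%R]])%E.

Definition coef (R : realType) (d : nat) (A : 'M[R]_d) (i j : 'I_d) (t : R) : R :=
  (expmx (t *: A) *m A) i j.

(* The default 0 of the maxima is harmless since all the suprema are >= 0. *)
Definition C2 (R : realType) (d : nat) (A : 'M[R]_d) : R :=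
  \big[Num.max/0]_(i < d) \big[Num.max/0]_(j < d)
     sup [set `|coef A i j t| ^+ 2 | t in `[0, 1]]
  + \big[Num.max/0]_(i < d) \big[Num.max/0]_(j < d)
     sup [set `|coef A i j t| | t in `[0, 1]]
  + 1.

(* Main.v *)
Require Import Defs.
From mathcomp Require Import all_boot all_order all_algebra.
From mathcomp Require Import all_classical all_reals all_analysis.
From mathcomp Require Import measurable_realfun ring lra zify.
Import Order.TTheory GRing.Theory Num.Theory.
Import numFieldNormedType.Exports.
Local Open Scope classical_set_scope.
Local Open Scope ring_scope.

(** The constant may depend on [A] and [d], and [C2 A >= 1], so it is enough to
    bound the expected supremum by [K (1 + 1 / sqrt H)] with [K] depending on
    [A] and [d] only. Two independent estimates give this.

    From the noise to the solution. Fix two outcomes [w] and [w']. The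
    difference [X t w - X t w'] solves the integral equation driven by
    [B t w - B t w'] with initial value 0, so a Gronwall argument
    ([gronwall_linear], [sde_stability]) bounds it by
    [K (V w + V w')], where [V] dominates the supremum of the noise.
    Since [X t w - E X t] is the average of [X t w - X t w'] over [w'], it is at
    most [K (V w + E V)] for all [t] at once ([sde_deviation_le]). Integrating
    in [w] gives [E sup |X - E X| <= 2 K E V] ([expected_sup_deviation_le]).
    Averaging over a second outcome spares an equation for the mean, hence any
    exchange of the time integral with the expectation.

    The supremum of fractional Brownian motion. The increments are Gaussian of
    variance [|t - s|^(2H)], hence sub-Gaussian ([fbm1_incr_mgf_le]). The
    supremum is bounded by chaining along the nested grids of mesh [N^-n].
    Dyadic grids would only give the order [H^(-3/2)]; the right order
    [H^(-1/2)] needs a mesh adapted to [H], namely [N = 2^m] with [m] about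
    [1 / H], so that the standard deviation of the increments is at
    least halved from one grid to the next ([mesh_powR_le]). Level [n] has about
    [2^(m (n + 1))] increments of standard deviation at most [2^-n], whose maximum
    has expectation at most of order [2^-n (n + 1) sqrt m] ([integral_level_le],
    [mesh_card_le]), and the sum over [n] is of order [sqrt m], that is
    [H^(-1/2)] ([chaining_bound]). Each maximum is replaced by
    an explicit sum of exponentials, and the supremum by a series of these,
    which makes the dominating variable [V] measurable by construction. *)

Set Implicit Arguments.
Unset Strict Implicit.
Unset Printing Implicit Defensive.

(** * Gaussian variables *)

Section Gaussian.
Variable R : realType.
Implicit Types m s x lam : R.
Local Notation mu := (@lebesgue_measure R).

(** The change of variables holds for the Radon-Nikodym derivative of the
    normal law, which agrees almost everywhere with the explicit density. *)
Lemma ge0_integral_normal_prob m s (f : R -> \bar R) :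
  (forall x, 0 <= f x)%E -> measurable_fun [set: R] f ->
  (\int[normal_prob m s]_x f x = \int[mu]_x (f x * (normal_pdf m s x)%:E))%E.
Proof.
move=> f0 mf.
have dom := normal_prob_dominates m s.
rewrite -(Radon_Nikodym_SigmaFinite.change_of_variables dom f0 measurableT mf).
have intRN := Radon_Nikodym_SigmaFinite.f_integrable dom.
apply: ae_eq_integral => //.
- by apply: emeasurable_funM => //; exact: measurable_int intRN.
- apply: emeasurable_funM => //.
  exact: measurable_int (integrable_normal_pdf m s).
- apply: ae_eqe_mul2l; apply: integral_ae_eq => //.
  + exact: measurable_int (integrable_normal_pdf m s).
  + by move=> E _ mE; rewrite -Radon_Nikodym_SigmaFinite.f_integral.
Qed.

(** Completing the square turns [expR (lam * x)] times the density into a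
    multiple of the density centered at [m + lam * s ^+ 2]. *)
Lemma integral_expR_normal_prob m s lam : 0 < s ->
  (\int[normal_prob m s]_x (expR (lam * x))%:E =
   (expR (lam * m + lam ^+ 2 * s ^+ 2 / 2))%:E)%E.
Proof.
move=> s0.
rewrite ge0_integral_normal_prob; last 2 first.
- by move=> x; rewrite lee_fin expR_ge0.
- by apply/measurable_EFinP/measurableT_comp.
under eq_integral => x _.
  rewrite (_ : (_ * _)%E = (expR (lam * m + lam ^+ 2 * s ^+ 2 / 2))%:E *
     (normal_pdf (m + lam * s ^+ 2) s x)%:E)%E; last first.
    rewrite -!EFinM /normal_pdf gt_eqF// /normal_fun.
    rewrite mulrCA [in RHS]mulrCA -!expRD; congr ((_ * expR _)%:E).
    by field; lra.
  over.
rewrite integralZl//; last exact: integrable_normal_pdf.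
by rewrite integral_normal_pdf mule1.
Qed.

Lemma normal_pdf_le m s x : 0 < s -> normal_pdf m s x <= (2 * s)^-1.
Proof.
move=> s0; apply: (le_trans (normal_pdf_ub _ _ _)); first by rewrite gt_eqF.
rewrite /normal_peak lef_pV2 ?posrE ?mulr_gt0//; last first.
  by rewrite sqrtr_gt0 mulrn_wgt0// mulr_gt0 ?pi_gt0// exprn_gt0.
rewrite -[leLHS]ger0_norm ?mulr_ge0 ?(ltW s0)// -sqrtr_sqr ler_wsqrtr//.
rewrite (_ : s ^+ 2 * pi *+ 2 = s ^+ 2 * (2 * pi)); last by ring.
rewrite exprMn mulrC ler_wpM2l ?sqr_ge0//.
by have := pi_ge2 R; lra.
Qed.

Variables (disp : measure_display) (T : measurableType disp).
Variable P : probability T R.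

Lemma law_ge0_integral (Y : T -> R) m s (f : R -> \bar R) :
  measurable_fun [set: T] Y ->
  (forall U, measurable U -> P (Y @^-1` U) = normal_prob m s U) ->
  measurable_fun [set: R] f -> (forall x, 0 <= f x)%E ->
  (\int[P]_w f (Y w) = \int[normal_prob m s]_x f x)%E.
Proof.
move=> mY lawY mf f0.
(* The normal law lives on [measurableTypeR R], whose display is not that
   of [R]; the sigma-algebras themselves are convertible. *)
have mY' : @measurable_fun _ _ T (measurableTypeR R) setT Y := mY.
pose Z : {mfun T >-> measurableTypeR R} :=
  @mfun_Sub _ _ T (measurableTypeR R) Y (mem_set mY').
transitivity (\int[distribution P Z]_x f x)%E.
  by rewrite ge0_integral_distribution.
by apply: eq_measure_integral => A mA _; exact: lawY.
Qed.

Section Law.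
Variables (Y : T -> R) (m s : R).
Hypothesis mY : measurable_fun [set: T] Y.
Hypothesis s0 : 0 < s.
Hypothesis lawY : forall U, measurable U -> P (Y @^-1` U) = normal_prob m s U.

Lemma law_integral_expR lam :
  (\int[P]_w (expR (lam * Y w))%:E =
   (expR (lam * m + lam ^+ 2 * s ^+ 2 / 2))%:E)%E.
Proof.
rewrite -integral_expR_normal_prob//.
apply: (@law_ge0_integral Y m s (fun x => (expR (lam * x))%:E)) => //.
  by apply/measurable_EFinP/measurableT_comp.
Qed.

(** Since [expR (lam * Y) >= 1 + lam * Y], a zero mean forces
    [lam * m + lam ^+ 2 * s ^+ 2 / 2 >= 0] for every [lam]; the minimum of this
    quadratic is negative unless [m = 0]. *)
Lemma law_centered : P.-integrable [set: T] (EFin \o Y) ->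
  (\int[P]_w (Y w)%:E = 0)%E -> m = 0.
Proof.
move=> intY EY0.
have key lam : 0 <= lam * m + lam ^+ 2 * s ^+ 2 / 2.
  rewrite -ler_expR expR0 -lee_fin -law_integral_expR.
  have intY1 : P.-integrable [set: T] (fun w => (1 + lam * Y w)%:E).
    apply: (eq_integrable measurableT _ (cst 1 \+ (fun w => lam%:E * (Y w)%:E))%E) => //.
    apply: integrableD => //; first exact: finite_measure_integrable_cst.
    exact: integrableZl.
  have E1 : (\int[P]_w (1 + lam * Y w)%:E = 1)%E.
    under eq_integral do rewrite EFinD EFinM.
    rewrite integralD//; last 2 first.
    - exact: finite_measure_integrable_cst.
    - exact: integrableZl.
    rewrite integralZl// EY0 mule0 adde0 integral_cst// mul1e; exact: probability_setT.
  rewrite -[leLHS]E1; apply: le_integral => //.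
    apply/integrableP; split.
      by apply/measurable_EFinP/measurableT_comp => //; exact: measurable_funM.
    under eq_integral do rewrite gee0_abs ?lee_fin ?expR_ge0//.
    by rewrite law_integral_expR ltry.
  by move=> w _; rewrite lee_fin expR_ge1Dx.
have := key (- m / s ^+ 2).
have -> : - m / s ^+ 2 * m + (- m / s ^+ 2) ^+ 2 * s ^+ 2 / 2 =
    - (m ^+ 2 / (2 * s ^+ 2)) by field; rewrite gt_eqF.
rewrite oppr_ge0 pmulr_lle0 ?invr_gt0 ?mulr_gt0 ?exprn_gt0// => m2.
by apply/eqP; rewrite -sqrf_eq0 eq_le m2 sqr_ge0.
Qed.

(** A small-ball estimate that avoids computing the second moment of the
    normal law: the density is at most [(2 * s)^-1], so [Y] lies within [s / 2]
    of 0 with probability at most 1/2, and [Y ^+ 2 >= s ^+ 2 / 4] otherwise. *)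
Lemma law_scale_le v : (\int[P]_w (Y w ^+ 2)%:E = v%:E)%E -> s ^+ 2 <= 8 * v.
Proof.
move=> EY2; pose I := `[- (s / 2), s / 2]%classic : set R.
have mI0 : measurable I by exact: measurable_itv.
have mI : measurable (Y @^-1` I).
  by rewrite -[X in measurable X]setTI; exact: mY.
have muI : mu I = s%:E.
  rewrite lebesgue_measure_itv/= lte_fin ifT ?gtrN ?divr_gt0//.
  by congr EFin; rewrite opprK -splitr.
have PI : (P (Y @^-1` I) <= (2^-1)%:E)%E.
  rewrite lawY// /normal_prob.
  apply: (@le_trans _ _ (\int[mu]_(x in I) ((2 * s)^-1)%:E)%E).
    apply: ge0_le_integral => //.
    - by move=> x _; rewrite lee_fin normal_pdf_ge0.
    - by apply/measurable_funTS/measurable_EFinP; exact: measurable_normal_pdf.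
    - by move=> x _; rewrite lee_fin normal_pdf_le.
  rewrite integral_cst// [X in (_ * X <= _)%E]muI -EFinM lee_fin le_eqVlt.
  by apply/orP; left; apply/eqP; field; rewrite gt_eqF.
have c0 : 0 <= s ^+ 2 / 4 by rewrite divr_ge0// sqr_ge0.
have mY2 : measurable_fun [set: T] (fun w => (Y w ^+ 2)%:E).
  by apply/measurable_EFinP; exact: measurable_funX.
have mI1 : measurable_fun [set: T] (fun w => ((s ^+ 2 / 4)%:E * (\1_(Y @^-1` I) w)%:E)%E).
  by apply/measurable_EFinP; exact: measurable_funM.
have I10 w : (0 <= (s ^+ 2 / 4)%:E * (\1_(Y @^-1` I) w)%:E)%E.
  by rewrite -EFinM lee_fin mulr_ge0.
have Y20 w : (0 <= (Y w ^+ 2)%:E)%E by rewrite lee_fin sqr_ge0.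
have : ((s ^+ 2 / 4)%:E <= v%:E + (s ^+ 2 / 4)%:E * P (Y @^-1` I))%E.
  rewrite -EY2 -[in leRHS](setIT (Y @^-1` I)) -integral_indic//.
  rewrite -ge0_integralZl//; last exact/measurable_EFinP.
  rewrite -ge0_integralD// -[leLHS]mule1 -(probability_setT P) -integral_cst//.
  apply: ge0_le_integral => //; first exact: emeasurable_funD.
  move=> w _; rewrite -EFinM -EFinD lee_fin indicE.
  have [wI|wI] := boolP (w \in _); first by rewrite mulr1 lerDr sqr_ge0.
  rewrite mulr0 addr0; move: wI; rewrite notin_setE /I /= in_itv/= => /negP.
  rewrite negb_and -!ltNge => sY.
  have {}sY : s / 2 <= `|Y w|.
    by rewrite ler_normr orbC; case/orP: sY => /ltW; rewrite 1?lerNr => ->; rewrite ?orbT.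
  rewrite -(real_normK (num_real (Y w))) (_ : s ^+ 2 / 4 = (s / 2) ^+ 2); last by field.
  by rewrite lerXn2r// nnegrE// divr_ge0// ltW.
move=> /le_trans h.
have /h : (v%:E + (s ^+ 2 / 4)%:E * P (Y @^-1` I) <= (v + s ^+ 2 / 4 * 2^-1)%:E)%E.
  by rewrite EFinD leeD2l// [leRHS]EFinM lee_wpmul2l.
by clear EY2 PI h muI mY2 mI1 I10 Y20; rewrite lee_fin; lra.
Qed.

End Law.

(** The constant 4 comes from [s ^+ 2 / 2 <= 4 * v]; it covers the degenerate
    case as well. *)
Lemma gaussian_rv_mgf_le (Y : T -> R) v lam : gaussian_rv P Y ->
  P.-integrable [set: T] (EFin \o Y) -> (\int[P]_w (Y w)%:E = 0)%E ->
  (\int[P]_w (Y w ^+ 2)%:E = v%:E)%E ->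
  (\int[P]_w (expR (lam * Y w))%:E <= (expR (4 * lam ^+ 2 * v))%:E)%E.
Proof.
move=> [mY [[m Ym]|[m [s [s0 lawY]]]]] intY EY EY2.
  have cstE (f : R -> R) : measurable_fun [set: R] f ->
      (\int[P]_w (f (Y w))%:E = (f m)%:E)%E.
    move=> mf; rewrite -[RHS]mule1 -(probability_setT P) -integral_cst//.
    apply: ae_eq_integral => //; first by apply/measurable_EFinP/measurableT_comp.
    by apply: filterS Ym => w -> _.
  rewrite (cstE (fun x => expR (lam * x))); last exact: measurableT_comp.
  have := cstE id (@measurable_id _ _ _); rewrite EY => -[<-].
  rewrite mulr0 lee_fin ler_expR.
  have v0 : 0 <= v.
    by rewrite -lee_fin -EY2; apply: integral_ge0 => w _; rewrite lee_fin sqr_ge0.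
  by rewrite -mulrA; apply: mulr_ge0 => //; apply: mulr_ge0 => //; exact: sqr_ge0.
have m0 := law_centered mY s0 lawY intY EY; rewrite {}m0 in lawY.
have := law_scale_le mY s0 lawY EY2.
rewrite (law_integral_expR mY s0 lawY) mulr0 add0r lee_fin ler_expR.
by clear - R; have := sqr_ge0 lam; nra.
Qed.

End Gaussian.

(** * Increments of fractional Brownian motion *)

Section FbmIncrements.
Variables (R : realType) (disp : measure_display) (T : measurableType disp).
Variables (P : probability T R) (H : R) (b : R -> T -> R).
Hypothesis H01 : 0 < H < 1.
Hypothesis fbm_b : fbm1 P H b.
Implicit Types t s : R.

Lemma fbm1_measurable t : t \in `[0, 1] -> measurable_fun [set: T] (b t).
Proof.
move=> t01; have [+ _] := fbm1_gaussian fbm_b (fun=> 1) (fun _ : 'I_1 => t01).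
by under eq_fun do rewrite big_ord1 mul1r.
Qed.

Lemma fbm1_incr_gaussian t s : t \in `[0, 1] -> s \in `[0, 1] ->
  gaussian_rv P (fun w => b t w - b s w).
Proof.
move=> t01 s01.
pose pt (k : 'I_2) := if k == 0 then t else s.
pose c (k : 'I_2) : R := if k == 0 then 1 else -1.
have pt01 k : pt k \in `[0, 1] by rewrite /pt; case: ifP.
have := fbm1_gaussian fbm_b c pt01.
by under eq_fun do rewrite !big_ord_recl big_ord0 /= mul1r mulN1r addr0.
Qed.

Lemma fbm1_integral_sqr t : t \in `[0, 1] ->
  (\int[P]_w (b t w ^+ 2)%:E = (`|t| `^ (2 * H))%:E)%E.
Proof.
move=> t01; have := fbm1_covariance fbm_b t01 t01.
rewrite unlock subrr normr0 powR0; last by case/andP: H01 => ? _; rewrite mulf_neq0// gt_eqF.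
by move=> ->; congr EFin; field.
Qed.

Lemma fbm1_integrable_sqr t : t \in `[0, 1] ->
  P.-integrable [set: T] (fun w => (b t w ^+ 2)%:E).
Proof.
move=> t01; apply/integrableP; split.
  by apply/measurable_EFinP/measurable_funX/fbm1_measurable.
under eq_integral do rewrite gee0_abs ?lee_fin ?sqr_ge0//.
by rewrite fbm1_integral_sqr// ltry.
Qed.

(** The variance is finite and [`|y| <= 1 + y ^+ 2]. *)
Lemma fbm1_integrable t : t \in `[0, 1] -> P.-integrable [set: T] (EFin \o b t).
Proof.
move=> t01; apply: (@le_integrable _ _ _ _ _ measurableT _
    (cst 1 \+ (fun w => (b t w ^+ 2)%:E))%E).
- exact/measurable_EFinP/fbm1_measurable.
- move=> w _ /=; rewrite lee_fin [leRHS]ger0_norm ?addr_ge0 ?sqr_ge0//.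
  rewrite -(real_normK (num_real (b t w))).
  by have := sqr_ge0 (`|b t w| - 2^-1); nra.
- apply: integrableD => //; first exact: finite_measure_integrable_cst.
  exact: fbm1_integrable_sqr.
Qed.

Lemma fbm1_integrableM t s : t \in `[0, 1] -> s \in `[0, 1] ->
  P.-integrable [set: T] (fun w => (b t w * b s w)%:E).
Proof.
move=> t01 s01; apply: (@le_integrable _ _ _ _ _ measurableT _
    ((fun w => (b t w ^+ 2)%:E) \+ (fun w => (b s w ^+ 2)%:E))%E).
- by apply/measurable_EFinP/measurable_funM; exact: fbm1_measurable.
- move=> w _ /=; rewrite lee_fin [leRHS]ger0_norm ?addr_ge0 ?sqr_ge0//.
  rewrite normrM -(real_normK (num_real (b t w))) -(real_normK (num_real (b s w))).
  have := sqr_ge0 (`|b t w| - `|b s w|); have := normr_ge0 (b t w).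
  by have := normr_ge0 (b s w); nra.
- by apply: integrableD => //; exact: fbm1_integrable_sqr.
Qed.

Lemma fbm1_integral t : t \in `[0, 1] -> (\int[P]_w (b t w)%:E = 0)%E.
Proof. by move=> t01; have := fbm1_centered fbm_b t01; rewrite unlock. Qed.

Lemma fbm1_incr_sqr t s : t \in `[0, 1] -> s \in `[0, 1] ->
  (\int[P]_w ((b t w - b s w) ^+ 2)%:E = (`|t - s| `^ (2 * H))%:E)%E.
Proof.
move=> t01 s01.
have cov := fbm1_covariance fbm_b t01 s01; rewrite unlock in cov.
have ists := fbm1_integrableM t01 s01.
transitivity (\int[P]_w ((b t w ^+ 2)%:E + (b s w ^+ 2)%:E +
    (-2)%:E * (b t w * b s w)%:E))%E.
  by apply: eq_integral => w _; rewrite -EFinM -!EFinD; congr EFin; ring.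
rewrite integralD//; last 2 first.
- by apply: integrableD => //; exact: fbm1_integrable_sqr.
- exact: integrableZl.
rewrite integralD ?integralZl//; try exact: fbm1_integrable_sqr.
rewrite !fbm1_integral_sqr// cov -EFinM -!EFinD; congr EFin.
by field.
Qed.

Lemma fbm1_incr_mgf_le t s lam : t \in `[0, 1] -> s \in `[0, 1] ->
  (\int[P]_w (expR (lam * (b t w - b s w)))%:E <=
   (expR (4 * lam ^+ 2 * `|t - s| `^ (2 * H)))%:E)%E.
Proof.
move=> t01 s01; apply: (gaussian_rv_mgf_le (Y := fun w => b t w - b s w)).
- exact: fbm1_incr_gaussian.
- apply: (eq_integrable measurableT ((EFin \o b t) \- (EFin \o b s))%E) => //.
  by apply: integrableB => //; exact: fbm1_integrable.
- under eq_integral do rewrite EFinB.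
  by rewrite integralB_EFin ?fbm1_integral ?sube0//; exact: fbm1_integrable.
- exact: fbm1_incr_sqr.
Qed.

End FbmIncrements.

(** * Chaining along nested grids *)

Section Grid.
Variables (R : realType) (N : nat).
Hypothesis N_gt1 : (1 < N)%N.
Implicit Types t : R.

(** Point number [k] of the grid of mesh [N^-n]. The parent of point [k] of level
    [n.+1] is point [k %/ N] of level [n]. *)
Definition grid n k : R := k%:R / N%:R ^+ n.
Definition grid_index n t := Num.truncn (t * N%:R ^+ n).

Let N0 : 0 < N%:R :> R. Proof. by rewrite ltr0n ltnW. Qed.
Let Nn0 n : 0 < N%:R ^+ n :> R. Proof. exact: exprn_gt0. Qed.

Lemma grid_itv n k : (k <= N ^ n)%N -> grid n k \in `[0, 1].
Proof.
move=> kN; rewrite in_itv/= divr_ge0 ?ler0n ?(ltW (Nn0 n))//=.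
by rewrite ler_pdivrMr// mul1r -natrX ler_nat.
Qed.

Lemma grid_index_le n t : t \in `[0, 1] -> (grid_index n t <= N ^ n)%N.
Proof.
rewrite in_itv/= => /andP[t0 t1]; rewrite -(ler_nat R) natrX.
rewrite (@le_trans _ _ (t * N%:R ^+ n))//.
  by rewrite truncn_le mulr_ge0// ltW.
by rewrite ler_piMl// ltW.
Qed.

(** Rounding [t] down to a coarser grid is the same as rounding down twice; this
    is what makes the increments of a chain telescope. *)
Lemma grid_index_divn n t : 0 <= t ->
  (grid_index n.+1 t %/ N)%N = grid_index n t.
Proof.
move=> t0; apply/esym/truncn_def.
have x0 : 0 <= t * N%:R ^+ n.+1 by rewrite mulr_ge0// ltW.
have /andP[lo hi] := truncn_itv x0.
rewrite -(ler_pM2r N0) -(ltr_pM2r N0) -mulrA -exprSr -!natrM.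
apply/andP; split.
  by rewrite (le_trans _ lo)// ler_nat leq_divM.
by rewrite (lt_le_trans hi)// ler_nat ltn_ceil// ltnW.
Qed.

Lemma grid_parent_dist n k :
  `|grid n.+1 k - grid n (k %/ N)| <= (N%:R ^+ n)^-1.
Proof.
have -> : grid n.+1 k - grid n (k %/ N) = (k %% N)%:R / N%:R ^+ n.+1.
  rewrite /grid {1}(divn_eq k N) natrD natrM exprS.
  by field; rewrite expf_neq0 gt_eqF.
rewrite ger0_norm ?divr_ge0 ?ler0n ?(ltW (Nn0 _))// ler_pdivrMr// exprS mulrCA mulVf ?gt_eqF//.
by rewrite mulr1 ler_nat ltnW// ltn_mod ltnW.
Qed.

Lemma grid_approx t : 0 <= t ->
  grid n (grid_index n t) @[n --> \oo] --> t.
Proof.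
move=> t0; apply/cvgrPdist_le => e e0.
near=> n.
have x0 : 0 <= t * N%:R ^+ n by rewrite mulr_ge0// ltW.
have /andP[lo hi] := truncn_itv x0.
have -> : t - grid n (grid_index n t) =
    (t * N%:R ^+ n - (grid_index n t)%:R) / N%:R ^+ n.
  by rewrite /grid; field; rewrite gt_eqF.
rewrite ger0_norm; last by rewrite divr_ge0 ?subr_ge0 ?(ltW (Nn0 n)).
rewrite (@le_trans _ _ (N%:R^-1 ^+ n))//.
  rewrite exprVn ler_pdivrMr// mulVf ?gt_eqF// lerBlDr.
  by move: hi; rewrite -natr1 addrC => /ltW.
rewrite -[leLHS]subr0 -[leLHS]ger0_norm ?subr0 ?exprn_ge0 ?invr_ge0 ?(ltW N0)//.
rewrite -normrN -sub0r.
near: n.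
have : N%:R^-1 ^+ n @[n --> \oo] --> (0 : R).
  by apply: cvg_expr; rewrite ger0_norm ?invr_ge0 ?(ltW N0)// invf_lt1 ?ltr1n.
by move/cvgrPdist_le; apply.
Unshelve. all: by end_near. Qed.

Variable f : R -> R.

Definition link n k := f (grid n.+1 k) - f (grid n (k %/ N)).

Lemma link_telescope n t : 0 <= t ->
  f (grid n (grid_index n t)) =
  f (grid 0 (grid_index 0 t)) + \sum_(j < n) link j (grid_index j.+1 t).
Proof.
move=> t0; elim: n => [|n IH]; first by rewrite big_ord0 addr0.
by rewrite big_ord_recr/= addrA -IH /link grid_index_divn// addrC subrK.
Qed.

(** Deterministic half of chaining: by continuity [f t] is the limit of its values
    at the grid approximations of [t], each of which is a telescoping sum of one
    link per level. The chain starts at 0, or at 1 when [t = 1]. *)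
Lemma norm_le_chain t (base : R) (u : nat -> R) :
  t \in `[0, 1] -> {within `[0, 1], continuous f} ->
  `|f 0| <= base -> `|f 1| <= base ->
  (forall n k, (k <= N ^ n.+1)%N -> `|link n k| <= u n) ->
  (`|f t|%:E <= base%:E + \sum_(n <oo) (u n)%:E)%E.
Proof.
move=> t01 cf b0 b1 linku.
have t0 : 0 <= t by move: t01; rewrite in_itv/= => /andP[].
have u0 n : 0 <= u n by rewrite (le_trans _ (linku n 0%N _)).
set V := (\sum_(n <oo) _)%E.
have V0 : (0 <= V)%E by apply: nneseries_ge0 => n _ _; rewrite lee_fin.
have gridV n : (`|f (grid n (grid_index n t))|%:E <= base%:E + V)%E.
  apply: (@le_trans _ _ (base + \sum_(j < n) u j)%:E).
    rewrite lee_fin link_telescope// (le_trans (ler_normD _ _))// lerD//.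
      rewrite /grid expr0 divr1; have := grid_index_le 0 t01; rewrite expn0.
      by case: (grid_index 0 t) => [|[|]].
    apply: (le_trans (ler_norm_sum _ _ _)); apply: ler_sum => j _.
    exact/linku/grid_index_le.
  rewrite EFinD leeD2l// -sumEFin -(big_mkord xpredT (fun j => (u j)%:E)).
  by apply: nneseries_lim_ge => n' _ _; rewrite lee_fin.
have {}cf : f (grid n (grid_index n t)) @[n --> \oo] --> f t.
  have /subspace_continuousP/(_ t t01) := cf.
  apply: cvg_comp => A; rewrite /within/= => nA.
  have /(_ _ nA) := grid_approx t0; rewrite /nbhs/=.
  apply: filterS => n; apply => /=.
  exact/grid_itv/grid_index_le.
move: V0 gridV; case: V => [v| |] //= v0 gridV; last by rewrite addey// leey.
rewrite -EFinD lee_fin -(cvg_lim _ (cvg_norm cf))//.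
apply: limr_le; first exact: cvgP (cvg_norm cf).
by apply: nearW => n; have := gridV n; rewrite -EFinD lee_fin.
Qed.

End Grid.

Section Chaining.
Variable R : realType.

(** Combines [x <= expR x] with [expR `|x| <= expR x + expR (- x)]. The free
    parameter [a] trades the linear term against the exponential one. *)
Lemma normr_le_cosh (a lam y : R) : 0 < lam ->
  `|y| <= a + lam^-1 * expR (- (lam * a)) * (expR (lam * y) + expR (- lam * y)).
Proof.
move=> lam0.
have h : `|y| - a <= lam^-1 * expR (lam * (`|y| - a)).
  rewrite ler_pdivlMl// (le_trans _ (expR_ge1Dx _))//.
  by rewrite lerDr.
rewrite -lerBlDl (le_trans h)// -mulrA ler_wpM2l ?invr_ge0 ?(ltW lam0)//.
rewrite mulrBr addrC expRD ler_wpM2l ?expR_ge0//.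
have [y0|y0] := ger0P y; first by rewrite lerDl expR_ge0.
by rewrite mulrN -mulNr lerDr expR_ge0.
Qed.

Variables (disp : measure_display) (T : measurableType disp).
Variable P : probability T R.

(** An upper bound for [max_k `|Y k|] that is explicit in the [Y k]: this is
    [normr_le_cosh] at [a = 5 * sigma * l] and [lam = l / sigma], summed over [k].
    For variables of scale [sigma] the exponentials have expectation at most
    [expR (4 * l ^+ 2)], which the factor [expR (- (5 * l ^+ 2))] beats with room
    for [expR (l ^+ 2)] variables. *)
Definition level (I : finType) (Y : I -> T -> R) (sigma l : R) (w : T) : R :=
  sigma * (5 * l) + sigma / l * expR (- (5 * l ^+ 2)) *
    \sum_(k : I) (expR (l / sigma * Y k w) + expR (- (l / sigma) * Y k w)).

Section Level.
Variables (I : finType) (Y : I -> T -> R) (sigma l : R).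
Hypotheses (sigma0 : 0 < sigma) (l1 : 1 <= l).
Hypothesis mY : forall k, measurable_fun [set: T] (Y k).
Hypothesis subgauss : forall k lam,
  (\int[P]_w (expR (lam * Y k w))%:E <= (expR (4 * lam ^+ 2 * sigma ^+ 2))%:E)%E.

Let l0 : 0 < l. Proof. exact: lt_le_trans l1. Qed.

Lemma measurable_level : measurable_fun [set: T] (level Y sigma l).
Proof.
apply: measurable_funD => //; apply: measurable_funM => //.
apply: measurable_sum => k; apply: measurable_funD; apply: measurableT_comp => //;
  exact: measurable_funM.
Qed.

Lemma normr_le_level k w : `|Y k w| <= level Y sigma l w.
Proof.
have ls0 : 0 < l / sigma by rewrite divr_gt0.
apply: (le_trans (normr_le_cosh (sigma * (5 * l)) (Y k w) ls0)).
rewrite /level lerD2l invf_div.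
have -> : l / sigma * (sigma * (5 * l)) = 5 * l ^+ 2 by field; rewrite gt_eqF.
rewrite ler_wpM2l ?mulr_ge0 ?expR_ge0 ?invr_ge0 ?(ltW l0) ?(ltW sigma0)//.
by rewrite (bigD1 k)//= lerDl sumr_ge0// => j _; rewrite addr_ge0 ?expR_ge0.
Qed.

Lemma level_ge0 w : 0 <= level Y sigma l w.
Proof.
rewrite /level addr_ge0// !mulr_ge0 ?invr_ge0 ?expR_ge0 ?(ltW l0) ?(ltW sigma0)//.
by rewrite sumr_ge0// => k _; rewrite addr_ge0// expR_ge0.
Qed.

(** The maximum of [n] sub-Gaussian variables of scale [sigma] has expectation of
    order [sigma * sqrt (ln n)]; the hypothesis says that [l] is at least of order
    [sqrt (ln n)]. *)
Lemma integral_level_le : 2 * #|I|%:R <= expR (l ^+ 2) ->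
  (\int[P]_w (level Y sigma l w)%:E <= (sigma * (6 * l))%:E)%E.
Proof.
move=> cardI.
have mexp k lam : measurable_fun [set: T] (fun w => (expR (lam * Y k w))%:E).
  apply/measurable_EFinP; apply: measurableT_comp => //; exact: measurable_funM.
have exp0 k lam w : (0 <= (expR (lam * Y k w))%:E)%E by rewrite lee_fin expR_ge0.
pose c := sigma / l * expR (- (5 * l ^+ 2)).
have c0 : 0 <= c by rewrite /c mulr_ge0 ?expR_ge0// divr_ge0 ?ltW.
rewrite (_ : (\int[P]_w (level Y sigma l w)%:E =
  (sigma * (5 * l))%:E + c%:E * \sum_(k : I) (\int[P]_w (expR (l / sigma * Y k w))%:E
     + \int[P]_w (expR (- (l / sigma) * Y k w))%:E))%E); last first.
  pose S w := (\sum_(k : I) ((expR (l / sigma * Y k w))%:E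
        + (expR (- (l / sigma) * Y k w))%:E))%E.
  have levelE w : (level Y sigma l w)%:E = ((sigma * (5 * l))%:E + c%:E * S w)%E.
    rewrite /level -/c EFinD; congr (_ + _)%E.
    by rewrite EFinM -sumEFin.
  have S0 w : (0 <= S w)%E.
    by rewrite sume_ge0// => k _; rewrite adde_ge0.
  have mS : measurable_fun [set: T] S.
    by apply: emeasurable_sum => k; apply: emeasurable_funD; exact: mexp.
  have s0 : (0 <= (sigma * (5 * l))%:E)%E by rewrite lee_fin !mulr_ge0// ltW.
  under eq_integral do rewrite levelE.
  rewrite ge0_integralD//; last 2 first.
  - by move=> w _; rewrite mule_ge0.
  - exact: emeasurable_funM.
  rewrite integral_cst// [X in (_ * X + _)%E]probability_setT mule1; congr (_ + _)%E.
  rewrite ge0_integralZl//.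
  congr (_ * _)%E; rewrite ge0_integral_sum//; last 2 first.
  - by move=> k; apply: emeasurable_funD; exact: mexp.
  - by move=> k w _; rewrite lee_fin addr_ge0// expR_ge0.
  by apply: eq_bigr => k _; rewrite ge0_integralD//; exact: mexp.
have subg k lam : (lam * sigma) ^+ 2 = l ^+ 2 ->
    (\int[P]_w (expR (lam * Y k w))%:E <= (expR (4 * l ^+ 2))%:E)%E.
  by move=> <-; rewrite exprMn mulrA; exact: subgauss.
apply: (@le_trans _ _ ((sigma * (5 * l))%:E +
    c%:E * \sum_(k : I) (2 * expR (4 * l ^+ 2))%:E)%E).
  rewrite leeD2l// lee_wpmul2l// lee_sum// => k _.
  rewrite mulr_natl mulr2n EFinD leeD// subg//.
    by rewrite divfK ?gt_eqF.
  by rewrite mulNr sqrrN divfK ?gt_eqF.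
rewrite sumEFin -EFinM -EFinD lee_fin sumr_const -(mulr_natr (2 * expR _)).
have -> : c * (2 * expR (4 * l ^+ 2) * #|I|%:R) =
    sigma / l * (2 * #|I|%:R * expR (- l ^+ 2)).
  rewrite /c (_ : - l ^+ 2 = - (5 * l ^+ 2) + 4 * l ^+ 2); last by ring.
  by rewrite expRD; ring.
rewrite (_ : 6 * l = 5 * l + l); last by ring.
rewrite mulrDr lerD2l -mulrA ler_wpM2l ?(ltW sigma0)//.
rewrite expRN -ler_pdivlMl ?invr_gt0// invrK.
rewrite ler_pdivrMr ?expR_gt0// (le_trans cardI)// ler_peMl ?expR_ge0//.
by rewrite -expr2 expr_ge1// ltW.
Qed.

End Level.

Lemma sum_succ_half_powers n : \sum_(k < n) (k.+1%:R / 2 ^+ k : R) <= 4.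
Proof.
suff -> : \sum_(k < n) (k.+1%:R / 2 ^+ k : R) = 4 - 2 * n.+2%:R / 2 ^+ n.
  by rewrite gerBl divr_ge0 ?exprn_ge0// mulr_ge0.
elim: n => [|n IH]; first by rewrite big_ord0 expr0; field.
rewrite big_ord_recr/= IH exprS; field.
by rewrite expf_neq0.
Qed.

End Chaining.

(** * Supremum of a process with sub-Gaussian increments *)

Section MeshSize.
Variable R : realType.

(** Any [m >= 1 / H] makes refining the mesh by [2 ^ m] at least halve the standard
    deviation, mesh to the power [H]; [m <= 1 / H + 1] keeps [sqrt m] of order
    [H^(-1/2)]. *)
Definition mesh_exponent (H : R) : nat := (Num.truncn H^-1).+1.

Lemma mesh_exponent_ge (H : R) : 0 < H -> 1 <= (mesh_exponent H)%:R * H.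
Proof.
move=> H0; rewrite -ler_pdivrMr// mul1r ltW//; exact: truncnS_gt.
Qed.

Lemma sqrt_mesh_exponent_le (H : R) : 0 < H < 1 ->
  Num.sqrt (mesh_exponent H)%:R <= 2 / Num.sqrt H.
Proof.
move=> /andP[H0 H1].
have sH : 0 < Num.sqrt H by rewrite sqrtr_gt0.
rewrite -[leRHS]ger0_norm ?divr_ge0 ?(ltW sH)// -sqrtr_sqr ler_wsqrtr//.
rewrite exprMn exprVn sqr_sqrtr ?(ltW H0)//.
have tr : (Num.truncn H^-1)%:R <= H^-1 by rewrite truncn_le invr_ge0 ltW.
have H1' : 1 <= H^-1 by rewrite invf_ge1// ltW.
rewrite /mesh_exponent -natr1; lra.
Qed.

Lemma mesh_powR_le (H x : R) n : 0 < H -> 0 <= x ->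
  x <= (((2 ^ mesh_exponent H)%:R : R) ^+ n)^-1 ->
  x `^ (2 * H) <= ((2 ^+ n)^-1) ^+ 2.
Proof.
move=> H0 x0 xle; have mH := mesh_exponent_ge H0.
have H20 : 0 <= 2 * H by rewrite mulr_ge0// ltW.
apply: (@le_trans _ _ (((2 ^ mesh_exponent H)%:R ^+ n)^-1 `^ (2 * H))).
  by apply: ge0_ler_powR => //; rewrite nnegrE// invr_ge0 exprn_ge0.
rewrite natrX -exprM -powR_mulrn// -powRN -powRrM.
rewrite exprVn -exprM -powR_mulrn// -powRN ler_powR ?ler1n//.
have := ler_wpM2l (ler0n R n) mH; rewrite !natrM; lra.
Qed.

(** Size condition of [integral_level_le] for the chosen parameter, which grows
    like [n] where [sqrt n] would do: the sum over levels still converges, and [m]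
    still enters through its square root. *)
Lemma mesh_card_le (m n : nat) : (0 < m)%N ->
  2 * (((2 ^ m) ^ n.+1).+1)%:R <= expR ((2 * Num.sqrt m%:R * n.+1%:R) ^+ 2) :> R.
Proof.
move=> m0; apply: (@le_trans _ _ (2 ^+ (m * n.+1 + 2))).
  rewrite -natrM -natrX ler_nat -expnM expnD mulnC -addn1 mulnDl mul1n.
  by have := expn_gt0 2 (m * n.+1); lia.
apply: (@le_trans _ _ (expR 1 ^+ (m * n.+1 + 2))).
  by rewrite lerXn2r// ?nnegrE ?expR_ge0// -[leLHS]/(1 + 1) expR_ge1Dx.
rewrite -expRM_natl mulr1 ler_expR !exprMn sqr_sqrtr// -!natrX -!natrM ler_nat.
nia.
Qed.

End MeshSize.

Section SupBound.
Variables (R : realType) (disp : measure_display) (T : measurableType disp).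
Variables (P : probability T R) (H : R) (b : R -> T -> R).
Hypothesis H01 : 0 < H < 1.
Hypothesis mb : forall t : R, t \in `[0, 1] -> measurable_fun [set: T] (b t).
Hypothesis cb : forall w, {within `[0, 1], continuous (b ^~ w)}.
Hypothesis var_b : forall t : R, t \in `[0, 1] -> (\int[P]_w (b t w ^+ 2)%:E <= 1)%E.
Hypothesis subgauss_b : forall t s lam : R, t \in `[0, 1] -> s \in `[0, 1] ->
  (\int[P]_w (expR (lam * (b t w - b s w)))%:E <=
   (expR (4 * lam ^+ 2 * `|t - s| `^ (2 * H)))%:E)%E.

(** The 4 bounds the expectation of [base], which dominates the starting point
    of the chains. The 96 collects the factor 12 of each level, the value 4 of the
    series of [n.+1 / 2 ^ n], and [sqrt m <= 2 / sqrt H]. *)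
Lemma chaining_bound : exists V : T -> \bar R,
  [/\ measurable_fun [set: T] V, (forall w, 0 <= V w)%E,
      (forall w (t : R), t \in `[0%R, 1%R] -> `|b t w|%:E <= V w)%E &
      (\int[P]_w V w <= (4 + 96 / Num.sqrt H)%:E)%E].
Proof.
have [H0 H1] := andP H01.
pose m := mesh_exponent H; pose N := (2 ^ m)%N.
have N1 : (1 < N)%N by rewrite -(expn0 2) ltn_exp2l.
have sm1 : 1 <= Num.sqrt (m%:R : R) by rewrite -[leLHS]sqrtr1 ler_wsqrtr// ler1n.
pose sigma n : R := (2 ^+ n)^-1.
have sigma0 n : 0 < sigma n by rewrite invr_gt0 exprn_gt0.
pose l n : R := 2 * Num.sqrt m%:R * n.+1%:R.
have l1 n : 1 <= l n by rewrite !mulr_ege1// ?ler1n.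
pose Y n (k : 'I_(N ^ n.+1).+1) w := link N (b ^~ w) n k.
have kN n (k : 'I_(N ^ n.+1).+1) : (k <= N ^ n.+1)%N by rewrite -ltnS.
have kN' n (k : 'I_(N ^ n.+1).+1) : (k %/ N <= N ^ n)%N.
  by rewrite -(@leq_pmul2r N) ?(ltnW N1)// -expnSr (leq_trans (leq_divM _ _)).
have mY n k : measurable_fun [set: T] (Y n k).
  by apply: measurable_funB; apply: mb; apply: grid_itv.
have subgaussY n k lam : (\int[P]_w (expR (lam * Y n k w))%:E <=
    (expR (4 * lam ^+ 2 * sigma n ^+ 2))%:E)%E.
  apply: (le_trans (subgauss_b lam (grid_itv _ N1 (kN _ k)) (grid_itv _ N1 (kN' _ k)))).
  rewrite lee_fin ler_expR ler_wpM2l ?(mulr_ge0 _ (sqr_ge0 lam))//.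
  by apply: mesh_powR_le => //; exact: grid_parent_dist.
pose u n w := level (Y n) (sigma n) (l n) w.
have mu n : measurable_fun [set: T] (fun w => (u n w)%:E).
  by apply/measurable_EFinP/measurable_level.
have u0 n w : (0 <= (u n w)%:E)%E by rewrite lee_fin level_ge0.
have in0 : 0 \in `[0, 1 : R] by rewrite in_itv/= lexx ler01.
have in1 : 1 \in `[0, 1 : R] by rewrite in_itv/= lexx ler01.
pose base w := (1 + b 0 w ^+ 2) + (1 + b 1 w ^+ 2).
have m1 t : t \in `[0, 1] -> measurable_fun [set: T] (fun w => 1 + b t w ^+ 2).
  by move=> t01; apply: measurable_funD => //; exact/measurable_funX/mb.
have ge01 t w : (0 <= (1 + b t w ^+ 2)%:E)%E by rewrite lee_fin addr_ge0// sqr_ge0.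
have base0 w : (0 <= (base w)%:E)%E by rewrite EFinD adde_ge0.
have mbase : measurable_fun [set: T] (fun w => (base w)%:E).
  by apply/measurable_EFinP/measurable_funD; exact: m1.
have mseries : measurable_fun [set: T] (fun w => (\sum_(n <oo) (u n w)%:E)%E).
  by apply: ge0_emeasurable_sum => // n w _ _.
have series0 w : (0 <= \sum_(n <oo) (u n w)%:E)%E by exact: nneseries_ge0.
have base_ge t : 0 <= 1 + t ^+ 2 :> R by rewrite addr_ge0// sqr_ge0.
have le1sqr (x : R) : `|x| <= 1 + x ^+ 2.
  rewrite -(real_normK (num_real x)).
  by have := sqr_ge0 (`|x| - 2^-1); nra.
exists (fun w => ((base w)%:E + \sum_(n <oo) (u n w)%:E)%E); split.
- exact: emeasurable_funD.
- by move=> w; exact: adde_ge0.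
- move=> w t t01; apply: (norm_le_chain N1 (f := b ^~ w)) => //.
  + by rewrite (le_trans (le1sqr _))// lerDl.
  + by rewrite (le_trans (le1sqr _))// lerDr.
  + move=> n k; rewrite -ltnS => klt.
    exact: (normr_le_level (Y n) (sigma0 n) (l1 n) (Ordinal klt)).
rewrite ge0_integralD// EFinD leeD//.
  have int1 t : t \in `[0, 1] -> (\int[P]_w (1 + b t w ^+ 2)%:E <= 2%:E)%E.
    move=> t01; under eq_integral do rewrite EFinD.
    rewrite ge0_integralD//; last 2 first.
    - by move=> w _; rewrite lee_fin sqr_ge0.
    - exact/measurable_EFinP/measurable_funX/mb.
    rewrite integral_cst// [X in (_ * X + _)%E]probability_setT mule1.
    by rewrite (_ : 2%:E = 1 + 1)%E// leeD2l// var_b.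
  under eq_integral do rewrite EFinD.
  rewrite ge0_integralD//; [|exact/measurable_EFinP/m1|exact/measurable_EFinP/m1].
  rewrite (_ : 4%:E = 2%:E + 2%:E)%E; last by rewrite -EFinD; congr EFin; ring.
  by rewrite leeD// int1.
rewrite integral_nneseries//.
have intu n : (\int[P]_w (u n w)%:E <= (12 * Num.sqrt m%:R * (n.+1%:R / 2 ^+ n))%:E)%E.
  apply: (le_trans (integral_level_le (sigma0 n) (l1 n) (mY n) (@subgaussY n) _)).
    by rewrite card_ord mesh_card_le.
  by rewrite lee_fin /l /sigma le_eqVlt; apply/orP; left; apply/eqP; ring.
apply: (@le_trans _ _ (48 * Num.sqrt m%:R)%:E); last first.
  rewrite lee_fin; have := sqrt_mesh_exponent_le H01; rewrite -/m; lra.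
apply: lime_le; first by apply: is_cvg_nneseries => n _ _; apply: integral_ge0.
apply: nearW => n; apply: (le_trans (lee_sum _ (fun k _ => intu k))).
rewrite sumEFin lee_fin -mulr_sumr big_mkord.
have := sum_succ_half_powers R n; have : 0 <= Num.sqrt m%:R :> R by [].
nra.
Qed.

End SupBound.

(** * A linear Gronwall estimate *)

Section Gronwall.
Variable R : realType.
Local Notation mu := (@lebesgue_measure R).

Lemma within_itv_integrable (g : R -> R) t : t \in `[0, 1] ->
  {within `[0, 1], continuous g} -> mu.-integrable `[0, t] (EFin \o g).
Proof.
move=> t01 cg; apply: continuous_compact_integrable.
  exact: segment_compact.
apply: continuous_subspaceW cg; apply: subset_itvl.
by move: t01; rewrite in_itv/= bnd_simp => /andP[].
Qed.

Lemma continuous_expRM (lam : R) : continuous (fun s : R => expR (lam * s)).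
Proof.
move=> s; apply: continuous_comp; last exact: continuous_expR.
by apply: cvgM; [exact: cvg_cst|exact: cvg_id].
Qed.

Lemma Rintegral_expR_le (t lam : R) : 0 <= t -> 0 < lam ->
  \int[mu]_(s in `[0, t]) expR (lam * s) <= expR (lam * t) / lam.
Proof.
move=> t0 lam0; rewrite le_eqVlt in t0; case/orP: t0 => [/eqP <-|t0].
  by rewrite set_itv1 Rintegral_set1 divr_ge0 ?expR_ge0// ltW.
pose F s := expR (lam * s) / lam.
have dF (s : R) : is_derive s 1 F (expR (lam * s)).
  apply: is_derive_eq; rewrite ?scaler0 ?add0r ?addr0 /GRing.scale/=.
  by field; rewrite gt_eqF.
have cexp := @continuous_expRM lam.
have cF : continuous F.
  by move=> s; apply: cvgM; [exact: cexp|exact: cvg_cst].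
rewrite /Rintegral (@continuous_FTC2 _ _ F)//.
- by rewrite /F mulr0 expR0 /= gerBl divr_ge0 ?ltW.
- exact: continuous_subspaceT.
- split; first by move=> s _; exact: ex_derive.
    by apply: cvg_at_right_filter; exact: cF.
  by apply: cvg_at_left_filter; exact: cF.
- by move=> s _; rewrite derive1E derive_val.
Qed.

Lemma normr_Rintegral_le_expR (g : R -> R) (c t lam : R) :
  t \in `[0, 1] -> 0 < lam -> 0 <= c -> {within `[0, 1], continuous g} ->
  (forall s, s \in `[0, 1] -> `|g s| <= c * expR (lam * s)) ->
  `|\int[mu]_(s in `[0, t]) g s| <= c * (expR (lam * t) / lam).
Proof.
move=> t01 lam0 c0 cg gle.
have /andP[t0 t1] : 0 <= t <= 1 by move: t01; rewrite in_itv.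
have ig := within_itv_integrable t01 cg.
have iexp : mu.-integrable `[0, t] (EFin \o (fun s => expR (lam * s))).
  by apply: within_itv_integrable => //; apply: continuous_subspaceT; exact: continuous_expRM.
apply: (le_trans (le_normr_Rintegral _ ig)) => //.
apply: (@le_trans _ _ (\int[mu]_(s in `[0, t]) (c * expR (lam * s)))).
  apply: le_Rintegral => //.
  - exact: (integrable_abse ig).
  - apply: within_itv_integrable => //; apply: continuous_subspaceT => s.
    by apply: cvgM; [exact: cvg_cst|exact: continuous_expRM].
  - move=> s /=; rewrite in_itv/= => /andP[s0 st]; apply: gle.
    by rewrite in_itv/= s0 (le_trans st t1).
by rewrite RintegralZl// ler_wpM2l// Rintegral_expR_le.
Qed.

Lemma within_continuous_sum (I : finType) (D : set R) (f : I -> R -> R) :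
  (forall i, {within D, continuous (f i)}) ->
  {within D, continuous (fun t => \sum_i f i t)}.
Proof.
move=> cf; apply: (@continuous_big R I +%R 0 xpredT _ (subspace D)).
  exact: add_continuous.
by move=> i _; exact: cf.
Qed.

(** Weighting by [expR (- lam * t)] with [lam = 2 * a] makes the integral operator
    a contraction of ratio 1/2: at a point where the weighted norm attains its
    maximum [M], the equation gives [M <= M / 2 + S]. *)
Lemma gronwall_linear (d : nat) (A : 'M[R]_d) (Z beta : R -> 'cV[R]_d) (S : R) :
  {within `[0, 1], continuous Z} ->
  (forall t i, t \in `[0, 1] -> Z t i 0 =
     \int[mu]_(s in `[0, t]) (A *m Z s) i 0 + beta t i 0) ->
  (forall t, t \in `[0, 1] -> \sum_i `|beta t i 0| <= S) ->
  forall t, t \in `[0, 1] ->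
  \sum_i `|Z t i 0| <= 2 * S * expR (2 * (1 + \sum_i \sum_j `|A i j|)).
Proof.
move=> cZ eqZ betaS.
(* The summand 1 keeps [lam] positive when [A = 0]. *)
pose a := 1 + \sum_i \sum_j `|A i j|; pose lam := 2 * a; rewrite -/a.
have a1 : 1 <= a by rewrite lerDl sumr_ge0// => i _; rewrite sumr_ge0.
have lam0 : 0 < lam by rewrite mulr_gt0// (lt_le_trans _ a1).
pose phi t := \sum_i `|Z t i 0|.
have cZi i : {within `[0, 1], continuous (fun s => Z s i 0)}.
  move=> s; apply: (@cvg_comp _ _ _ Z (fun M : 'cV[R]_d => M i 0) _ (nbhs (Z s))).
    exact: cZ.
  exact: coord_continuous.
have cphi : {within `[0, 1], continuous phi}.
  by apply: within_continuous_sum => i s; apply: cvg_norm; exact: cZi.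
have cw : {within `[0, 1], continuous (fun s => expR (- lam * s) * phi s)}.
  have cexp : {within `[0, 1], continuous (fun s : R => expR (- lam * s))}.
    by apply: continuous_subspaceT; exact: continuous_expRM.
  by move=> s; apply: cvgM; [exact: cexp|exact: cphi].
have [c c01 maxc] := EVT_max (@ler01 R) cw.
set M := expR (- lam * c) * phi c in maxc.
have phi0 s : 0 <= phi s by rewrite sumr_ge0.
have M0 : 0 <= M by rewrite mulr_ge0 ?expR_ge0.
have phiM s : s \in `[0, 1] -> phi s <= M * expR (lam * s).
  move=> /maxc; rewrite mulNr expRN mulrC ler_pdivrMr ?expR_gt0//.
have int_le i : `|\int[mu]_(s in `[0, c]) (A *m Z s) i 0| <=
    (\sum_j `|A i j|) * M * (expR (lam * c) / lam).
  apply: normr_Rintegral_le_expR => //.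
  - by rewrite mulr_ge0// sumr_ge0.
  - rewrite (_ : (fun s => _) = fun s => \sum_j A i j * Z s j 0); last first.
      by apply/funext => s; rewrite mxE.
    apply: within_continuous_sum => j s.
    by apply: cvgM; [exact: cvg_cst|exact: cZi].
  - move=> s s01; apply: (@le_trans _ _ ((\sum_j `|A i j|) * phi s)); last first.
      by rewrite -mulrA ler_wpM2l ?phiM// sumr_ge0.
    rewrite mxE mulr_suml (le_trans (ler_norm_sum _ _ _))// ler_sum// => j _.
    by rewrite normrM ler_wpM2l// /phi (bigD1 j)//= lerDl sumr_ge0.
have phic : phi c <= M * expR (lam * c) / 2 + S.
  apply: (@le_trans _ _ (\sum_i ((\sum_j `|A i j|) * M * (expR (lam * c) / lam)
      + `|beta c i 0|))).
    apply: ler_sum => i _; rewrite eqZ// (le_trans (ler_normD _ _))// lerD2r.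
    exact: int_le.
  rewrite big_split/= lerD ?betaS//.
  under eq_bigr do rewrite -mulrA; rewrite -mulr_suml.
  rewrite (_ : _ / 2 = a * (M * (expR (lam * c) / lam))); last first.
    by rewrite /lam; field; rewrite gt_eqF// (lt_le_trans _ a1).
  rewrite ler_wpM2r ?lerDr// mulr_ge0// divr_ge0 ?expR_ge0 ?(ltW lam0)//.
have c0 : 0 <= c by move: c01; rewrite in_itv/= => /andP[].
have S0 : 0 <= S by apply: le_trans (betaS c c01); rewrite sumr_ge0.
have M2S : M <= 2 * S.
  have E1 : expR (- lam * c) <= 1.
    by rewrite -expR0 ler_expR mulNr oppr_le0 mulr_ge0// ltW.
  have : M <= M / 2 + expR (- lam * c) * S.
    rewrite {1}/M (le_trans (ler_wpM2l (expR_ge0 _) phic))//.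
    have ec : expR (- lam * c) * expR (lam * c) = 1.
      by rewrite -expRD mulNr addNr expR0.
    rewrite [leLHS](_ : _ = M / 2 * (expR (- lam * c) * expR (lam * c))
      + expR (- lam * c) * S); last by ring.
    by rewrite ec mulr1.
  have : expR (- lam * c) * S <= S by rewrite ler_piMl.
  lra.
move=> t t01; apply: (le_trans (phiM _ t01)); rewrite ler_pM ?expR_ge0//.
rewrite ler_expR ler_piMr ?(ltW lam0)//.
by move: t01; rewrite in_itv/= => /andP[].
Qed.

End Gronwall.

(** * Fluctuations of the solution of the linear equation *)

Lemma norm2_le_sum_normr (R : realType) (d : nat) (v : 'cV[R]_d) :
  norm2 v <= \sum_i `|v i 0|.
Proof.
have s0 : 0 <= \sum_i `|v i 0| by rewrite sumr_ge0.
rewrite -[leRHS]ger0_norm// -sqrtr_sqr ler_wsqrtr// expr2 mulr_suml.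
apply: ler_sum => i _; rewrite -(real_normK (num_real (v i 0))) expr2.
by rewrite ler_wpM2l// (bigD1 i)//= lerDl sumr_ge0.
Qed.

(** Comparison of the suprema over simple functions. Measurability is left out
    because [f] will be a supremum of a process over an uncountable index set. *)
Lemma ge0_le_integralT_nonmeasurable (disp : measure_display)
    (T : measurableType disp) (R : realType) (mu : {measure set T -> \bar R})
    (f g : T -> \bar R) :
  (forall x, 0 <= f x)%E -> (forall x, f x <= g x)%E ->
  (\int[mu]_x f x <= \int[mu]_x g x)%E.
Proof.
move=> f0 fg; have g0 x : (0 <= g x)%E by exact: le_trans (fg x).
rewrite !ge0_integralTE//; apply: le_ereal_sup => _ [h hf <-].
by exists h => // x; exact: le_trans (fg x).
Qed.

Section SdeDeviation.
Variables (R : realType) (d : nat) (A : 'M[R]_d) (xi : 'cV[R]_d).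
Variables (disp : measure_display) (T : measurableType disp).
Variables (B X : R -> T -> 'cV[R]_d).
Hypothesis sol : linear_sde_solution A xi B X.

Definition stability_const : R := 2 * expR (2 * (1 + \sum_i \sum_j `|A i j|)).
Local Notation K := stability_const.

Lemma stability_const_gt0 : 0 < K.
Proof. by rewrite mulr_gt0// expR_gt0. Qed.

(** The initial value is common to both outcomes, so it cancels in the
    difference, which solves a linear equation driven by the difference of the
    noises. *)
Lemma sde_stability w w' (S : R) :
  (forall t : R, t \in `[0, 1] -> \sum_i `|B t w i 0 - B t w' i 0| <= S) ->
  forall t : R, t \in `[0, 1] -> \sum_i `|X t w i 0 - X t w' i 0| <= K * S.
Proof.
move=> BS t t01.
have cX v : {within `[0, 1], continuous (X ^~ v)} by exact: sde_continuous sol v.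
have iAX v i r : r \in `[0, 1] ->
    (@lebesgue_measure R).-integrable `[0, r] (fun s => ((A *m X s v) i 0)%:E).
  move=> r01; apply: (@within_itv_integrable _ (fun s => (A *m X s v) i 0)) => //.
  rewrite (_ : (fun s => _) = fun s => \sum_j A i j * X s v j 0); last first.
    by apply/funext => s; rewrite mxE.
  apply: within_continuous_sum => j s; apply: cvgM; first exact: cvg_cst.
  apply: (@cvg_comp _ _ _ (X ^~ v) (fun M : 'cV[R]_d => M j 0) _ (nbhs (X s v))).
    exact: cX.
  exact: coord_continuous.
pose Z s := X s w - X s w'; pose beta s := B s w - B s w'.
have cZ : {within `[0, 1], continuous Z}.
  by move=> s; apply: cvgB; exact: cX.
have eqZ r i : r \in `[0, 1] -> Z r i 0 =
    \int[lebesgue_measure]_(s in `[0, r]) (A *m Z s) i 0 + beta r i 0.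
  move=> r01; rewrite /Z /beta.
  transitivity ((\int[lebesgue_measure]_(s in `[0, r]) (A *m X s w) i 0 -
    \int[lebesgue_measure]_(s in `[0, r]) (A *m X s w') i 0) + beta r i 0).
    by rewrite (sde_equation sol w r01) (sde_equation sol w' r01) !mxE; ring.
  rewrite -RintegralB//; [|exact: iAX|exact: iAX].
  congr (_ + _).
  by apply: eq_Rintegral => s _; rewrite mulmxBr !mxE.
have betaS r : r \in `[0, 1] -> \sum_i `|beta r i 0| <= S.
  move=> /BS; apply: le_trans; rewrite le_eqVlt; apply/orP; left; apply/eqP.
  by apply: eq_bigr => i _; rewrite !mxE.
have := gronwall_linear cZ eqZ betaS t01.
rewrite mulrAC; apply: le_trans; rewrite le_eqVlt; apply/orP; left; apply/eqP.
by apply: eq_bigr => i _; rewrite !mxE.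
Qed.

Variable P : probability T R.
Variable V : T -> \bar R.
Hypotheses (mV : measurable_fun [set: T] V) (V0 : forall w, (0 <= V w)%E).
Hypothesis BV : forall w (t : R), t \in `[0%R, 1%R] ->
  ((\sum_i `|B t w i 0%R|)%R%:E <= V w)%E.
Hypothesis intV : (\int[P]_w V w < +oo)%E.
Local Notation EV := (\int[P]_w V w)%E.

Lemma sde_diff_le w w' (t : R) : t \in `[0%R, 1%R] ->
  ((\sum_i `|X t w i 0%R - X t w' i 0%R|)%R%:E <= K%:E * (V w + V w'))%E.
Proof.
move=> t01; have K0 := stability_const_gt0.
have KV (v : T) : (K%:E * (V v + +oo) = +oo)%E.
  by rewrite addey ?gt0_muley ?lte_fin// gt_eqF// (lt_le_trans _ (V0 v)) ?ltNy0.
have := @BV w; have := @BV w'; have := V0 w; have := V0 w'.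
have := KV w; have := KV w'.
case: (V w) => [r| |] //; case: (V w') => [r'| |] //.
- move=> _ _ r'0 r0 Br' Br; rewrite -EFinD -EFinM lee_fin; apply: sde_stability => // s s01.
  apply: (@le_trans _ _ (\sum_i (`|B s w i 0| + `|B s w' i 0|))).
    by apply: ler_sum => i _; rewrite ler_normB.
  rewrite big_split/= lerD//.
    by have := Br s s01; rewrite lee_fin.
  by have := Br' s s01; rewrite lee_fin.
- by move=> _ -> *; rewrite leey.
- by move=> h _ *; rewrite addeC h leey.
- by move=> h _ *; rewrite h leey.
Qed.

(** For fixed [w], [X t w - E X t] is the integral of [X t w - X t w'] over [w'],
    which [sde_diff_le] controls. That bound also gives the integrability of
    [X t], hence the existence of the mean. *)
Lemma sde_deviation_le w (t : R) : t \in `[0%R, 1%R] ->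
  ((norm2 (X t w - mean_vector P (X t)))%:E <= K%:E * (V w + EV))%E.
Proof.
move=> t01; have K0 := stability_const_gt0.
have EV0 : (0 <= EV)%E by exact: integral_ge0.
have mX i : measurable_fun [set: T] (fun w' => X t w' i 0) by exact: sde_measurable sol t i t01.
case Vw: (V w) (V0 w) => [r| |] // r0; last first.
  by rewrite addye ?gt0_muley ?leey ?lte_fin// gt_eqF// (lt_le_trans _ EV0) ?ltNy0.
have mdom : measurable_fun [set: T] (fun w' => K%:E * (r%:E + V w'))%E.
  by apply: emeasurable_funM => //; exact: emeasurable_funD.
have dom0 w' : (0 <= K%:E * (r%:E + V w'))%E.
  by rewrite mule_ge0 ?lee_fin ?(ltW K0)// adde_ge0.
have Edom : (\int[P]_w' (K%:E * (r%:E + V w')) = K%:E * (r%:E + EV))%E.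
  rewrite ge0_integralZl//; last 3 first.
  - exact: emeasurable_funD.
  - by move=> w' _; rewrite adde_ge0.
  - by rewrite lee_fin ltW.
  rewrite ge0_integralD// integral_cst//.
  by rewrite [X in (_ * (_ * X + _))%E]probability_setT mule1.
have diff_le w' : ((\sum_i `|X t w i 0%R - X t w' i 0%R|)%R%:E <= K%:E * (r%:E + V w'))%E.
  by rewrite -Vw sde_diff_le.
have idiff i : P.-integrable [set: T] (fun w' => (X t w i 0 - X t w' i 0)%:E).
  apply: (@le_integrable _ _ _ _ _ measurableT _ (fun w' => K%:E * (r%:E + V w'))%E).
  - by apply/measurable_EFinP; exact: measurable_funB.
  - move=> w' _; rewrite [leRHS]gee0_abs//; apply: le_trans (diff_le w').
    by rewrite lee_fin (bigD1 i)//= lerDl sumr_ge0.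
  - apply/integrableP; split=> //; under eq_integral do rewrite gee0_abs//.
    rewrite Edom lte_mul_pinfty ?lee_fin ?(ltW K0)//.
    by rewrite lte_add_pinfty// ltry.
have EX i : ((X t w i 0 - mean_vector P (X t) i 0)%:E =
    \int[P]_w' (X t w i 0 - X t w' i 0)%:E)%E.
  have icst : P.-integrable [set: T] (EFin \o cst (X t w i 0)).
    exact: finite_measure_integrable_cst.
  have iX : P.-integrable [set: T] (EFin \o (fun w' => X t w' i 0)).
    apply: (eq_integrable measurableT ((EFin \o cst (X t w i 0)%R) \-
        (fun w' => (X t w i 0%R - X t w' i 0%R)%R%:E))%E).
      by move=> w' _ /=; rewrite -EFinB; congr EFin; ring.
    exact: integrableB.
  under eq_integral do rewrite EFinB.
  rewrite (integralB_EFin (f1 := cst (X t w i 0)))//= integral_cst//.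
  rewrite [X in (_ * X - _)%E]probability_setT mule1 EFinB.
  congr (_ - _)%E; rewrite mxE unlock fineK//.
  exact: (integrable_fin_num measurableT iX).
apply: (@le_trans _ _ (\sum_i `|X t w i 0 - mean_vector P (X t) i 0|)%:E).
  rewrite lee_fin (le_trans (norm2_le_sum_normr _))// le_eqVlt; apply/orP; left.
  by apply/eqP; apply: eq_bigr => i _; rewrite !mxE.
rewrite -Edom -sumEFin.
apply: (@le_trans _ _ (\sum_i \int[P]_w' `|(X t w i 0 - X t w' i 0)%:E|)%E).
  apply: lee_sum => i _; rewrite -abse_EFin EX; apply: le_abse_integral => //.
  by case/integrableP: (idiff i).
rewrite -ge0_integral_sum//; last first.
  move=> i; apply: measurableT_comp => //; by case/integrableP: (idiff i).
apply: ge0_le_integral => //.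
- by move=> w' _; exact: sume_ge0.
- apply: emeasurable_sum => i; apply: measurableT_comp => //; by case/integrableP: (idiff i).
- by move=> w' _; rewrite sumEFin; exact: diff_le.
Qed.

(** The bound of [sde_deviation_le] does not depend on [t], so it passes to the
    supremum; integrating it counts [EV] twice. *)
Lemma expected_sup_deviation_le :
  (expected_sup_deviation P X <= (2 * K)%:E * EV)%E.
Proof.
have K0 := stability_const_gt0.
have EV0 : (0 <= EV)%E by exact: integral_ge0.
have EVfin : EV \is a fin_num by rewrite ge0_fin_numE.
apply: (@le_trans _ _ (\int[P]_w (K%:E * (V w + EV)))%E).
  apply: ge0_le_integralT_nonmeasurable => w.
    apply: le_trans (ereal_sup_ubound _); last first.
      by exists 0 => //; rewrite /= in_itv/= lexx ler01.
    by rewrite lee_fin sqrtr_ge0.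
  by apply: ge_ereal_sup => _ [t t01 <-]; exact: sde_deviation_le.
rewrite ge0_integralZl//; last 3 first.
- exact: emeasurable_funD.
- by move=> w _; rewrite adde_ge0.
- by rewrite lee_fin ltW.
rewrite ge0_integralD// -(fineK EVfin) integral_cst// [X in (_ + _ * X)%E]probability_setT.
by rewrite mule1 -EFinD -!EFinM lee_fin le_eqVlt; apply/orP; left; apply/eqP; ring.
Qed.

End SdeDeviation.

(** * The bound for the Ornstein-Uhlenbeck process *)

Lemma fbm1_sup_bound (R : realType) (disp : measure_display)
    (T : measurableType disp) (P : probability T R) (H : R) (b : R -> T -> R) :
  0 < H < 1 -> fbm1 P H b ->
  exists V : T -> \bar R,
  [/\ measurable_fun [set: T] V, (forall w, 0 <= V w)%E,
      (forall w (t : R), t \in `[0%R, 1%R] -> `|b t w|%:E <= V w)%E &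
      (\int[P]_w V w <= (4 + 96 / Num.sqrt H)%:E)%E].
Proof.
move=> H01 fb; apply: (chaining_bound H01).
- move=> t t01; exact: (fbm1_measurable fb t01).
- exact: fbm1_continuous fb.
- move=> t t01; rewrite (fbm1_integral_sqr H01 fb t01) lee_fin.
  move: t01 H01; rewrite in_itv/= => /andP[t0 t1] /andP[H0 _].
  apply: (@le_trans _ _ (1 `^ (2 * H))); last by rewrite powR1.
  by apply: ge0_ler_powR; rewrite ?nnegrE ?mulr_ge0 ?(ltW H0) ?ger0_norm.
- by move=> t s lam t01 s01; exact: fbm1_incr_mgf_le.
Qed.

(** The sum of the coordinates dominates the Euclidean norm, which reduces the
    vector case to one coordinate at a time. *)
Lemma fbm_sum_sup_bound (R : realType) (disp : measure_display)
    (T : measurableType disp) (P : probability T R) (d : nat) (H : R)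
    (B : R -> T -> 'cV[R]_d) :
  0 < H < 1 -> fbm P H B ->
  exists V : T -> \bar R,
  [/\ measurable_fun [set: T] V, (forall w, 0 <= V w)%E,
      (forall w (t : R), t \in `[0%R, 1%R] ->
         (\sum_i `|B t w i 0%R|)%R%:E <= V w)%E &
      (\int[P]_w V w <= (d%:R * (4 + 96 / Num.sqrt H))%:E)%E].
Proof.
move=> H01 [fB _].
have /choice[V hV] := fun i => fbm1_sup_bound H01 (fB i).
exists (fun w => \sum_i V i w)%E; split.
- by apply: emeasurable_sum => i; case: (hV i).
- by move=> w; apply: sume_ge0 => i _; case: (hV i).
- move=> w t t01; rewrite -sumEFin; apply: lee_sum => i _.
  by case: (hV i) => _ _ h _; exact: h.
- rewrite ge0_integral_sum//; [|by move=> i; case: (hV i)|by move=> i w _; case: (hV i)].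
  apply: (@le_trans _ _ (\sum_(i < d) (4 + 96 / Num.sqrt H)%:E)%E).
    by apply: lee_sum => i _; case: (hV i).
  by rewrite sumEFin sumr_const card_ord -[_ *+ d]mulr_natl.
Qed.

Lemma C2_ge1 (R : realType) (d : nat) (A : 'M[R]_d) : 1 <= C2 A.
Proof. by rewrite lerDr addr_ge0// bigmax_ge_id. Qed.

Theorem theorem4 (R : realType) (d : nat) (A : 'M[R]_d) (xi : 'cV[R]_d)
    (d_ge1 : (1 <= d)%N) :
  exists C : R, 0 < C /\
    forall (H : R), 0 < H < 1 ->
    forall (disp : measure_display) (T : measurableType disp)
      (P : probability T R) (B X : R -> T -> 'cV[R]_d),
    fbm P H B -> linear_sde_solution A xi B X ->
    (expected_sup_deviation P X <=
      (C * d%:R ^+ 2 * C2 A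
       + C * d%:R ^+ 2 * C2 A * Num.sqrt pi / (2 * Num.sqrt H))%:E)%E.
Proof.
have K0 := stability_const_gt0 A.
(* 384 = 2 * 192: the 2 comes from [expected_sup_deviation_le], and 192 makes
   the term in [sqrt pi / 2 >= 1 / 2] absorb the 96 of [fbm_sum_sup_bound]. *)
exists (384 * stability_const A); split; first by rewrite mulr_gt0.
move=> H H01 disp T P B X fB sol; have [H0 _] := andP H01.
have [V [mV V0 BV intV]] := fbm_sum_sup_bound H01 fB.
apply: (le_trans (expected_sup_deviation_le sol mV V0 BV _)).
  by rewrite (le_lt_trans intV)// ltry.
set K := stability_const A in K0 *.
apply: (le_trans (lee_wpmul2l _ intV)); first by rewrite lee_fin mulr_ge0// ltW.
rewrite -EFinM lee_fin.
have sH : 0 < (Num.sqrt H)^-1 by rewrite invr_gt0 sqrtr_gt0.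
have spi : 1 <= Num.sqrt pi :> R.
  by rewrite -[leLHS]sqrtr1 ler_wsqrtr//; have := pi_ge2 R; lra.
have d1 : 1 <= d%:R :> R by rewrite ler1n.
have dC : d%:R <= d%:R ^+ 2 * C2 A.
  by rewrite expr2 -mulrA ler_peMr// mulr_ege1// C2_ge1.
have HC : 4 + 96 / Num.sqrt H <= 192 * (1 + Num.sqrt pi / (2 * Num.sqrt H)).
  rewrite invfM; have := ler_wpM2r (ltW sH) spi; lra.
have HC0 : 0 <= 4 + 96 / Num.sqrt H by rewrite addr_ge0// mulr_ge0// ltW.
rewrite (_ : _ + _ = 2 * K * ((d%:R ^+ 2 * C2 A) *
   (192 * (1 + Num.sqrt pi / (2 * Num.sqrt H))))); last first.
  by rewrite invfM; ring.
rewrite ler_wpM2l ?mulr_ge0 ?(ltW K0)// ler_pM//.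
Qed.
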